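(* Let $X\in\mathbb{R}^{n\times d}$, let $A\in\mathbb{R}^{d\times d}$ be positive semi-definite, let $p=(p_1,\dots,p_n)$ be a probability distribution on $\{1,\dots,n\}$ and let $r>0$. Let $K\sim\mathrm{Poisson}(r)$ and, given $K$, let $\sigma=(\sigma_1,\dots,\sigma_K)$ be $K$ i.i.d. samples from $p$. Then $$\mathbb{E}\Big[\det\big(A+X_\sigma^\top X_\sigma\big)\Big]=\det\Big(A+\mathbb{E}\big[X_\sigma^\top X_\sigma\big]\Big),$$ where the expectations are over both $K$ and the i.i.d. samples.
   Context: For a sequence $\sigma=(\sigma_1,\dots,\sigma_K)\in\{1,\dots,n\}^K$ (repetitions allowed), $X_\sigma$ is the $K\times d$ matrix whose $i$-th row is row $\sigma_i$ of $X$, so $X_\sigma^\top X_\sigma=\sum_{i=1}^K x_{\sigma_i}x_{\sigma_i}^\top$ where $x_j^\top$ is the $j$-th row of $X$ (this is $0$ if $K=0$). *)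

(* Defs.v *)
From HB Require Import structures.
From mathcomp Require Import all_boot all_order all_algebra.
From mathcomp Require Import all_classical all_reals all_analysis.
Set Implicit Arguments.
Unset Strict Implicit.
Unset Printing Implicit Defensive.
Import Order.TTheory GRing.Theory Num.Theory.
Import numFieldNormedType.Exports.
Local Open Scope classical_set_scope.
Local Open Scope ring_scope.

(* Finite sequences over a countable type form a countable set, which carries
   the discrete sigma-algebra. *)
HB.instance Definition _ (I : countType) := isPointed.Build (seq I) [::].
HB.instance Definition _ (I : countType) :=
  @isMeasurable.Build default_measure_display (seq I)
    discrete_measurable discrete_measurable0
    discrete_measurableC discrete_measurableU.

Definition psdmx (R : realType) (d : nat) (A : 'M[R]_d) : Prop :=
  A^T = A /\ forall v : 'cV[R]_d, 0 <= (v^T *m A *m v) 0 0.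

Definition prob_vector (R : realType) (n : nat) (p : 'I_n -> R) : Prop :=
  (forall i, 0 <= p i) /\ \sum_(i < n) p i = 1.

Definition sample_rows (R : realType) (n d : nat) (X : 'M[R]_(n, d))
    (s : seq 'I_n) : 'M[R]_(size s, d) :=
  rowsub (tnth (in_tuple s)) X.

Definition sample_gram (R : realType) (n d : nat) (X : 'M[R]_(n, d))
    (s : seq 'I_n) : 'M[R]_d :=
  (sample_rows X s)^T *m sample_rows X s.

Definition cond_prob (disp : measure_display) (T : measurableType disp)
    (R : realType) (P : probability T R) (E F : set T) : R :=
  fine (P (E `&` F)) / fine (P F).

(* Conditionally on [K = k], the sequence sigma has the law of k i.i.d. samples
   from p, that is, the product distribution on k-tuples. *)
Definition poisson_iid_sample (disp : measure_display)
    (T : measurableType disp) (R : realType) (P : probability T R) (n : nat)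
    (p : 'I_n -> R) (r : R) (K : {RV P >-> nat})
    (sigma : {RV P >-> seq 'I_n}) : Prop :=
  [/\ forall k : nat, P [set w | K w = k] = (poisson_pmf r k)%:E,
      forall w : T, size (sigma w) = K w
    & forall (k : nat) (s : k.-tuple 'I_n),
        cond_prob P [set w | sigma w = tval s] [set w | K w = k]
        = \prod_(i < k) p (tnth s i)].

(* Entrywise expectation.  As ['E_P] is extended-real valued and [fine] sends
   infinite values to 0, this is meaningful only for integrable entries. *)
Definition expectation_mx (disp : measure_display) (T : measurableType disp)
    (R : realType) (P : probability T R) (m n : nat) (M : T -> 'M[R]_(m, n)) :
    'M[R]_(m, n) :=
  \matrix_(i, j) fine ('E_P[fun w => M w i j])%E.

Definition integrable_mx (disp : measure_display) (T : measurableType disp)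
    (R : realType) (P : probability T R) (m n : nat) (M : T -> 'M[R]_(m, n)) :
    Prop :=
  forall i j, P.-integrable [set: T] (fun w => (M w i j)%:E).

(* Main.v *)
Require Import Defs.
From HB Require Import structures.
From mathcomp Require Import all_boot all_order all_algebra.
From mathcomp Require Import all_classical all_reals all_analysis.
From mathcomp Require Import measurable_realfun ring.
Set Implicit Arguments.
Unset Strict Implicit.
Unset Printing Implicit Defensive.
Import Order.TTheory GRing.Theory Num.Theory.
Import numFieldNormedType.Exports.
Local Open Scope classical_set_scope.
Local Open Scope ring_scope.

(* If b_j counts the occurrences of j in sigma, the sampled Gram matrix is
   \sum_j b_j x_j x_j^T, so det (A + gram) is a function of the counts that is
   affine in each b_j separately (rank-one updates), hence a linear combination
   of square-free monomials \prod_(j in S) b_j.  Given K = k such a monomial has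
   mean k^_#|S| \prod_(j in S) p_j, and the Poisson law has factorial moments
   r^m; the expectation of the monomial is therefore \prod_(j in S) (r p_j), the
   value obtained by replacing each count by its mean. *)

(** * Rank-one updates and multiaffine functions *)

Lemma det_rank1_affine (R : comNzRingType) (d : nat) (B : 'M[R]_d)
    (u : 'cV[R]_d) (v : 'rV[R]_d) (t : R) :
  \det (B + t *: (u *m v)) = (1 - t) * \det B + t * \det (B + u *m v).
Proof.
(* The Schur complement moves the scalar s into the first row only, where the
   determinant is linear. *)
pose M s : 'M[R]_(1 + d) := block_mx 1%:M (- (s *: v)) u B.
have detM s : \det (M s) = \det (B + s *: (u *m v)).
  have -> : M s = block_mx 1%:M 0 u 1%:M *m
                  block_mx 1%:M (- (s *: v)) 0 (B + s *: (u *m v)).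
    rewrite mulmx_block !mul1mx !mul0mx !mulmx1 !addr0.
    by rewrite mulmxN -scalemxAr addrC addrK.
  by rewrite det_mulmx det_lblock det_ublock !det1 !mul1r.
have -> : \det B = \det (M 0) by rewrite detM scale0r addr0.
rewrite -detM -[u *m v]scale1r -detM.
apply: (determinant_multilinear (i0 := lshift d ord0)).
- apply/rowP => j; rewrite !mxE !(unsplitK (inl _)) !mxE.
  by case: (fintype.split j) => k; rewrite !mxE; ring.
- apply/matrixP => i j; rewrite !mxE.
  case: split_ordP => k kE; rewrite !mxE //.
  by have /eqP[] := neq_lift (lshift d ord0) i; rewrite kE [k]ord1.
- apply/matrixP => i j; rewrite !mxE.
  case: split_ordP => k kE; rewrite !mxE //.
  by have /eqP[] := neq_lift (lshift d ord0) i; rewrite kE [k]ord1.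
Qed.

(** Affinity in each variable is encoded as interpolation between the values at 0 and 1, so that no
    coefficient functions have to be named. *)
Definition multiaffine (R : nzRingType) (I : eqType)
    (f : (I -> R) -> R) : Prop :=
  forall (b : I -> R) (j : I),
    f b = (1 - b j) * f [eta b with j |-> 0] + b j * f [eta b with j |-> 1].

Lemma multiaffine_update (R : comNzRingType) (I : eqType)
    (f : (I -> R) -> R) (i : I) (x : R) :
  {homo f : b b' / b =1 b' >-> b = b'} -> multiaffine f ->
  multiaffine (fun b => f [eta b with i |-> x]).
Proof.
move=> f_ext f_aff b j; have [<-|ne_ij] := eqVneq i j.
  have E y : f [eta [eta b with i |-> y] with i |-> x] = f [eta b with i |-> x].
    by apply: f_ext => l /=; case: eqP.
  by rewrite !E; ring.
have E y : f [eta [eta b with j |-> y] with i |-> x]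
         = f [eta [eta b with i |-> x] with j |-> y].
  apply: f_ext => l /=.
  by case: (eqVneq l i) => // ->; rewrite (negPf ne_ij).
rewrite (f_aff [eta b with i |-> x] j) /= !E.
by rewrite eq_sym (negPf ne_ij).
Qed.

(** Variables are eliminated one at a time through f = f|0 + b_i (f|1 - f|0), where both
    restrictions are again multiaffine. The list [c] is chosen before [b], so expectations can later
    be taken term by term. *)
Lemma multiaffine_expansion (R : comNzRingType) (I : finType)
    (f : (I -> R) -> R) :
  {homo f : b b' / b =1 b' >-> b = b'} -> multiaffine f ->
  exists c : seq (R * {set I}),
    forall b, f b = \sum_(m <- c) m.1 * \prod_(j in m.2) b j.
Proof.
move=> f_ext f_aff.
(* The induction runs over a list [s] of the variables [g] may depend on. Keeping every monomial
   inside [s] ensures that a new variable [i] occurs in none of them, so multiplying by [b i] stays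
   square-free. *)
suff expand (s : seq I) (g : (I -> R) -> R) : uniq s -> multiaffine g ->
    (forall b b', {in s, b =1 b'} -> g b = g b') ->
  exists2 c : seq (R * {set I}),
    forall b, g b = \sum_(m <- c) m.1 * \prod_(j in m.2) b j
    & {in c, forall m : R * {set I}, {subset m.2 <= s}}.
  have [|c cE _] := expand (enum I) f (enum_uniq _) f_aff; last by exists c.
  by move=> b b' bE; apply: f_ext => i; rewrite bE ?mem_enum.
elim: s g => [|i s IHs] g /=.
  move=> _ _ g_dep; exists [:: (g (fun=> 0), finset.set0)] => [b|m].
    by rewrite big_seq1 big_set0 mulr1; exact: g_dep.
  by rewrite inE => /eqP-> j; rewrite inE.
move=> /andP[i_s uniq_s] g_aff g_dep.
have upd_dep x b b' : {in s, b =1 b'} ->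
    g [eta b with i |-> x] = g [eta b' with i |-> x].
  by move=> bE; apply: g_dep => j; rewrite inE /=; case: eqP => //= _ /bE.
have g_ext : {homo g : b b' / b =1 b' >-> b = b'}.
  by move=> b b' bE; apply: g_dep => j _; exact: bE.
have [||c0 c0E c0s] := IHs (fun b => g [eta b with i |-> 0]) uniq_s.
- exact: multiaffine_update.
- exact: upd_dep.
have [||c1 c1E c1s] := IHs (fun b => g [eta b with i |-> 1]
                                  - g [eta b with i |-> 0]) uniq_s.
- move=> b j /=; rewrite (multiaffine_update i 0 g_ext g_aff b j).
  by rewrite (multiaffine_update i 1 g_ext g_aff b j); ring.
- by move=> b b' bE; congr (_ - _); exact: upd_dep.
exists (c0 ++ [seq (m.1, i |: m.2) | m <- c1]) => [b|m].
  rewrite (g_aff b i) big_cat big_map /= -c0E.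
  have -> : \sum_(m <- c1) m.1 * \prod_(j in i |: m.2) b j
            = b i * (g [eta b with i |-> 1] - g [eta b with i |-> 0]).
    rewrite c1E big_distrr /= big_seq [RHS]big_seq; apply: eq_bigr => m mc1.
    by rewrite big_setU1 1?mulrCA //=; apply: contra i_s; exact: c1s.
  by ring.
rewrite mem_cat => /orP[/c0s sub j /sub|/mapP[m' /c1s sub ->] j].
  by rewrite inE orbC => ->.
by rewrite !inE => /predU1P[->|/sub ->]; rewrite ?eqxx ?orbT.
Qed.

(** * Factorial moments of multinomial counts *)

Lemma big_tuple_cons (R : nmodType) (I : finType) (k : nat)
    (F : seq I -> R) :
  \sum_(t : k.+1.-tuple I) F t = \sum_i \sum_(t : k.-tuple I) F (i :: t).
Proof.
rewrite pair_bigA /=.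
rewrite (reindex (fun u : I * k.-tuple I => cons_tuple u.1 u.2)) //=.
exists (fun t => (thead t, behead_tuple t)) => [[i t] _|t _] /=.
  by rewrite theadE; congr pair; apply: val_inj.
by apply: val_inj; rewrite /= [in RHS](tuple_eta t).
Qed.

(** Injections of m positions into k.+1 points either avoid the new point or send one of the m
    positions to it. For m = 0 the factor m cancels the truncated predecessor. *)
Lemma ffactSD (k m : nat) : (k.+1 ^_ m = k ^_ m + m * k ^_ m.-1)%N.
Proof.
case: m => [|m]; first by rewrite !ffactn0.
rewrite ffactSS ffactnSr /=.
have [le_mk|lt_km] := leqP m k; last by rewrite ffact_small ?muln0.
by rewrite [in RHS]mulnC -mulnDl addnS subnK.
Qed.

Lemma prod_count_cons (R : comNzRingType) (I : finType) (S : {set I}) (i : I)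
    (s : seq I) :
  \prod_(j in S) (count_mem j (i :: s))%:R
  = \prod_(j in S) (count_mem j s)%:R
    + (i \in S)%:R * \prod_(j in S :\ i) (count_mem j s)%:R :> R.
Proof.
have [iS|iS] := boolP (i \in S); last first.
  rewrite mul0r addr0; apply: eq_bigr => j jS /=.
  by case: eqP iS => // ->; rewrite jS.
rewrite !(big_setD1 i iS) /= eqxx natrD mulrDl addrC.
by congr (_ * _ + _ * _); apply: eq_bigr => j;
  rewrite !inE eq_sym => /andP[/negPf->].
Qed.

(** Induction on k, splitting off the first sample i. It either leaves the monomial over S unchanged
    or, when i is in S, removes the factor of i; summing over i matches the recurrence [ffactSD]. *)
Lemma multinomial_factorial_moment (R : comNzRingType) (I : finType)
    (p : I -> R) (S : {set I}) (k : nat) : \sum_i p i = 1 ->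
  \sum_(s : k.-tuple I)
     (\prod_(i <- s) p i) * \prod_(j in S) (count_mem j s)%:R
  = (k ^_ #|S|)%:R * \prod_(j in S) p j.
Proof.
move=> p1; elim: k S => [|k IHk] S.
  rewrite (big_pred1 (nil_tuple I)) => [|t]; last by apply/esym/eqP/tuple0.
  rewrite big_nil mul1r ffact0n cards_eq0; have [->|/set0Pn[j jS]] := eqVneq.
    by rewrite !big_set0 mulr1.
  by rewrite (big_setD1 j jS) /= !mul0r.
rewrite (big_tuple_cons _ (fun s => (\prod_(i <- s) p i)
                                    * \prod_(j in S) (count_mem j s)%:R)).
transitivity (\sum_i p i * ((k ^_ #|S|)%:R * \prod_(j in S) p j
    + (i \in S)%:R * ((k ^_ #|S|.-1)%:R * \prod_(j in S :\ i) p j))).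
  apply: eq_bigr => i _.
  transitivity (\sum_(t : k.-tuple I)
      (p i * ((\prod_(l <- t) p l) * \prod_(j in S) (count_mem j t)%:R)
       + p i * (i \in S)%:R *
         ((\prod_(l <- t) p l) * \prod_(j in S :\ i) (count_mem j t)%:R))).
    by apply: eq_bigr => t _; rewrite big_cons prod_count_cons; ring.
  rewrite big_split -!big_distrr /= !IHk mulrDr -mulrA.
  have [iS|iS] := boolP (i \in S); last by rewrite !mul0r.
  by rewrite (cardsD1 i S) iS.
under [LHS]eq_bigr do rewrite mulrDr.
rewrite big_split -big_distrl /= p1 mul1r ffactSD natrD mulrDl; congr (_ + _).
(* Only i in S contribute, and each p_i restores the factor missing from the product over S minus i,
   giving #|S| equal terms. *)
rewrite (bigID (mem S)) /= [X in _ + X]big1 ?addr0 => [|i /negPf->]; last first.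
  by rewrite mul0r mulr0.
rewrite (eq_bigr (fun=> (k ^_ #|S|.-1)%:R * \prod_(j in S) p j)) => [|i iS].
  by rewrite sumr_const -[LHS]mulr_natl natrM mulrA.
by rewrite iS mul1r mulrCA -big_setD1.
Qed.

(** * The Gram matrix and its determinant as functions of the counts *)

Lemma sample_gramE (R : realType) (n d : nat) (X : 'M[R]_(n, d))
    (s : seq 'I_n) :
  sample_gram X s
  = \sum_j (count_mem j s)%:R *: ((row j X)^T *m row j X).
Proof.
apply/matrixP => a c; rewrite summxE.
transitivity (\sum_(i <- s) X i a * X i c).
  rewrite mxE [RHS]big_tnth; apply: eq_bigr => i _.
  by rewrite !mxE.
elim: s => [|i s IHs].
  by rewrite big_nil big1 // => j _; rewrite !mxE mul0r.
rewrite big_cons {}IHs.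
have -> : X i a * X i c = \sum_j (i == j)%:R * (X j a * X j c).
  rewrite (bigD1 i) //= eqxx mul1r big1 ?addr0 // => j.
  by rewrite eq_sym => /negPf->; rewrite mul0r.
rewrite -big_split; apply: eq_bigr => j _ /=.
by rewrite !mxE !big_ord1 !mxE natrD mulrDl.
Qed.

Lemma sum_scale_update (R : nzRingType) (V : lmodType R) (I : finType)
    (M : I -> V) (b : I -> R) (j : I) (x : R) :
  \sum_i [eta b with j |-> x] i *: M i
  = \sum_(i | i != j) b i *: M i + x *: M j.
Proof.
rewrite (bigD1 j) //= eqxx addrC; congr (_ + _).
by apply: eq_bigr => i /negPf->.
Qed.

Lemma multiaffine_det (R : comNzRingType) (I : finType) (d : nat)
    (A : 'M[R]_d) (u : I -> 'cV[R]_d) (v : I -> 'rV[R]_d) :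
  multiaffine (fun b => \det (A + \sum_j b j *: (u j *m v j))).
Proof.
move=> b j; rewrite !sum_scale_update scale0r addr0 scale1r.
by rewrite (bigD1 j) //= [_ *: _ + _]addrC !addrA det_rank1_affine.
Qed.

(** Lets the mean of the Gram matrix be computed by the same expectation lemma as the mean of the
    determinant. *)
Lemma multiaffine_sum_entry (R : comNzRingType) (I : finType) (m n : nat)
    (M : I -> 'M[R]_(m, n)) (a : 'I_m) (c : 'I_n) :
  multiaffine (fun b => (\sum_j b j *: M j) a c).
Proof.
move=> b j; rewrite !sum_scale_update scale0r addr0 scale1r.
by rewrite (bigD1 j) //= !mxE; ring.
Qed.

(** * Expectations under the Poisson law and the sample *)

Lemma poisson_factorial_moment (R : realType) (r : R) (m : nat) : 0 < r ->
  (\sum_(k <oo) (poisson_pmf r k * (k ^_ m)%:R)%:E = (r ^+ m)%:E)%E.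
Proof.
move=> r0.
have pmf_ge0 k : (0 <= (poisson_pmf r k)%:E)%E.
  by rewrite lee_fin poisson_pmf_ge0.
have term_ge0 k : (0 <= (poisson_pmf r k * (k ^_ m)%:R)%:E)%E.
  by rewrite lee_fin mulr_ge0 ?poisson_pmf_ge0.
rewrite (nneseries_split 0 m) // add0n big_nat_cond big1 ?add0e; last first.
  by move=> k /andP[/andP[_ km] _]; rewrite ffact_small ?mulr0.
rewrite -nneseries_addn //.
(* The terms with k < m vanish. In the others the falling factorial cancels against the factorial in
   the mass function, leaving r^m times the mass at the shifted index. *)
have shift k : ((poisson_pmf r (k + m) * ((k + m) ^_ m)%:R)%:E
              = (r ^+ m)%:E * (poisson_pmf r k)%:E)%E.
  rewrite -EFinM /poisson_pmf r0 exprD; congr (_%:E).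
  rewrite -(ffact_fact (leq_addl k m)) addnK natrM.
  have ? : (k`!)%:R != 0 :> R by rewrite pnatr_eq0 -lt0n fact_gt0.
  have ? : ((k + m) ^_ m)%:R != 0 :> R.
    by rewrite pnatr_eq0 -lt0n ffact_gt0 leq_addl.
  by field; apply/andP.
rewrite (eq_eseriesr (fun k _ => shift k)) nneseriesZl //.
have := probability_setT (poisson_prob r 0).
rewrite /= /poisson_prob r0 -nneseries_esumT // => ->.
by rewrite mule1.
Qed.

Section poisson_sample.
Variables (R : realType) (n : nat) (p : 'I_n -> R) (r : R).
Variables (disp : measure_display) (T : measurableType disp).
Variables (P : probability T R) (K : {RV P >-> nat}).
Variables (sigma : {RV P >-> seq 'I_n}).
Hypotheses (p_prob : prob_vector p) (r_gt0 : 0 < r).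
Hypothesis sigma_law : poisson_iid_sample p r K sigma.

Lemma measurable_sample_stat (g : seq 'I_n -> R) :
  measurable_fun setT (fun w => (g (sigma w))%:E).
Proof.
by apply/measurable_EFinP; exact: (measurableT_comp (f := g)).
Qed.

Lemma sample_prob (k : nat) (s : k.-tuple 'I_n) :
  P (sigma @^-1` [set tval s] `&` K @^-1` [set k])
  = (poisson_pmf r k * \prod_(i <- s) p i)%:E.
Proof.
have [K_law _ s_law] := sigma_law.
have PK : P (K @^-1` [set k]) = (poisson_pmf r k)%:E := K_law k.
have : fine (P (sigma @^-1` [set tval s] `&` K @^-1` [set k]))
       / fine (P (K @^-1` [set k])) = \prod_(i < k) p (tnth s i) := s_law k s.
rewrite PK big_tuple => <- /=.
(* Since r > 0, every event K = k has positive mass, so the quotient defining the conditional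
   probability can be cleared. *)
have pmf_neq0 : poisson_pmf r k != 0.
  rewrite /poisson_pmf r_gt0 lt0r_neq0 // mulr_gt0 ?expR_gt0 //.
  by rewrite divr_gt0 ?exprn_gt0 // ltr0n fact_gt0.
rewrite mulrCA mulfV // mulr1 fineK // fin_num_measure //.
by apply: measurableI; exact: measurable_funPTI.
Qed.

(** The events K = k partition the space, and on each of them sigma takes finitely many values.
    Nonnegativity of [g] justifies the countable sum before any integrability is known. *)
Lemma integral_sample_stat (g : seq 'I_n -> R) : (forall s, 0 <= g s) ->
  (\int[P]_w (g (sigma w))%:E
   = \sum_(k <oo) (poisson_pmf r k
                   * \sum_(s : k.-tuple 'I_n) (\prod_(i <- s) p i) * g s)%:E)%E.
Proof.
move=> g_ge0; have [_ size_sigma _] := sigma_law.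
have mK k : measurable (K @^-1` [set k]) by exact: measurable_funPTI.
have msigma s : measurable (sigma @^-1` [set s]) by exact: measurable_funPTI.
have cover : [set: T] = \bigcup_k (K @^-1` [set k]).
  by apply/esym/seteqP; split => // w _; exists (K w).
rewrite [in LHS]cover ge0_integral_bigcup //=; last 3 first.
- by rewrite -cover; exact: measurable_sample_stat.
- by move=> w _; rewrite lee_fin.
- by move=> i j _ _ [w [/= <- <-]].
apply: eq_eseriesr => k _.
(* Where K = k, exactly one of these indicators is nonzero, that of the tuple [sigma w]. *)
transitivity (\int[P]_(w in K @^-1` [set k])
    (\sum_(s : k.-tuple 'I_n)
       (g s)%:E * (\1_(sigma @^-1` [set tval s]) w)%:E))%E.
  apply: eq_integral => w; rewrite inE /= => Kw.
  have sz : size (sigma w) == k by rewrite size_sigma Kw.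
  rewrite (bigD1 (Tuple sz)) //= indicE mem_set //= mule1 big1 ?adde0 //.
  move=> s ne_s.
  rewrite indicE memNset ?mule0 //= => E.
  by case/eqP: ne_s; apply: val_inj.
rewrite ge0_integral_sum //.
- rewrite big_distrr /= -sumEFin; apply: eq_bigr => s _.
  rewrite ge0_integralZl_EFin //; last first.
    by apply/measurable_EFinP; exact: measurable_indic.
  by rewrite integral_indic // [X in (_ * X)%E](sample_prob s) -EFinM
    mulrC mulrA.
- move=> s; apply: emeasurable_funM => //.
  by apply/measurable_EFinP; exact: measurable_indic.
- by move=> s w _; rewrite mule_ge0 ?lee_fin.
Qed.

Lemma integral_prod_count (S : {set 'I_n}) :
  (\int[P]_w (\prod_(j in S) (count_mem j (sigma w))%:R)%:E
   = (\prod_(j in S) (r * p j))%:E)%E.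
Proof.
rewrite (@integral_sample_stat (fun s => \prod_(j in S) (count_mem j s)%:R)).
  under eq_eseriesr do
    rewrite multinomial_factorial_moment ?p_prob.2 // mulrA EFinM muleC.
  rewrite nneseriesZl => [|k _].
    by rewrite poisson_factorial_moment // -EFinM big_split prodr_const mulrC.
  by rewrite lee_fin mulr_ge0 ?poisson_pmf_ge0.
by move=> s; apply: prodr_ge0.
Qed.

Lemma expectation_multiaffine_counts (f : ('I_n -> R) -> R) :
  {homo f : b b' / b =1 b' >-> b = b'} -> multiaffine f ->
  P.-integrable setT (fun w => (f (fun j => (count_mem j (sigma w))%:R))%:E)
  /\ ('E_P[fun w => f (fun j => (count_mem j (sigma w))%:R)]
      = (f (fun j => r * p j))%:E)%E.
Proof.
move=> f_ext /(multiaffine_expansion f_ext)[c cE].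
pose mono (S : {set 'I_n}) w : R := \prod_(j in S) (count_mem j (sigma w))%:R.
(* Monomials in the counts are nonnegative, so their finite integral already gives integrability;
   signed coefficients enter only through finite linear combinations. *)
have mono_int S : P.-integrable setT (EFin \o mono S).
  apply/integrableP; split.
    exact: (measurable_sample_stat
              (fun s => \prod_(j in S) (count_mem j s)%:R)).
  under eq_integral do rewrite gee0_abs ?lee_fin ?prodr_ge0 //.
  by rewrite integral_prod_count ltry.
have fE : (fun w => (f (fun j => (count_mem j (sigma w))%:R))%:E)
    = (fun w => \sum_(m <- c) m.1%:E * (mono m.2 w)%:E)%E.
  by apply/funext => w; rewrite cE -sumEFin.
have term_int (m : R * {set 'I_n}) :
    P.-integrable setT (fun w => m.1%:E * (mono m.2 w)%:E)%E.
  exact: (integrableZl measurableT m.1 (mono_int m.2)).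
split; first by rewrite fE; exact: integrable_sum.
rewrite unlock fE integral_sum // cE -sumEFin; apply: eq_bigr => m _.
by rewrite (integralZl measurableT (mono_int m.2))
  [X in (_ * X)%E]integral_prod_count.
Qed.

End poisson_sample.

Theorem lemma5 (R : realType) (n d : nat) (X : 'M[R]_(n, d)) (A : 'M[R]_d)
    (hA : psdmx A) (p : 'I_n -> R) (hp : prob_vector p) (r : R) (hr : 0 < r)
    (disp : measure_display) (T : measurableType disp) (P : probability T R)
    (K : {RV P >-> nat}) (sigma : {RV P >-> seq 'I_n})
    (hs : poisson_iid_sample p r K sigma) :
  [/\ integrable_mx P (fun w => sample_gram X (sigma w)),
      P.-integrable [set: T] (fun w => (\det (A + sample_gram X (sigma w)))%:E)
    & 'E_P[fun w => \det (A + sample_gram X (sigma w))]%E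
      = (\det (A + expectation_mx P (fun w => sample_gram X (sigma w))))%:E ].
Proof.
pose G (b : 'I_n -> R) := \sum_j b j *: ((row j X)^T *m row j X).
have G_ext b b' : b =1 b' -> G b = G b'.
  by move=> bE; apply: eq_bigr => j _; rewrite bE.
have gramE w :
    sample_gram X (sigma w) = G (fun j => (count_mem j (sigma w))%:R).
  exact: sample_gramE.
have entryE i j : (fun w => sample_gram X (sigma w) i j)
    = fun w => G (fun l => (count_mem l (sigma w))%:R) i j.
  by apply/funext => w; rewrite gramE.
have detE : (fun w => \det (A + sample_gram X (sigma w)))
    = fun w => \det (A + G (fun l => (count_mem l (sigma w))%:R)).
  by apply/funext => w; rewrite gramE.
have entry_moment i j := expectation_multiaffine_counts hp hr hs
  (fun b b' bE => congr1 (fun B : 'M[R]_d => B i j) (G_ext b b' bE))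
  (multiaffine_sum_entry (fun l => (row l X)^T *m row l X) i j).
have [det_int det_mean] := expectation_multiaffine_counts hp hr hs
  (fun b b' bE => congr1 (fun B => \det (A + B)) (G_ext b b' bE))
  (multiaffine_det A (fun j => (row j X)^T) (fun j => row j X)).
(* Each entry has a finite expectation, so [fine] loses nothing here. *)
have -> : expectation_mx P (fun w => sample_gram X (sigma w))
    = G (fun j => r * p j).
  by apply/matrixP => i j; rewrite mxE entryE (entry_moment i j).2.
split=> [i j||]; last by rewrite detE.
- under eq_fun do rewrite gramE.
  exact: (entry_moment i j).1.
- by under eq_fun do rewrite gramE.
Qed.
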